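(* Let $p$ be a prime, $q=p^n$ with $n\ge 1$, let $m>1$ be an integer, and let $k$ be a positive integer. Let $L:\mathbf{F}_{q^m}\to \mathbf{F}_{q^m}$ be (the map induced by) a linearized polynomial such that $\dim_{\mathbf{F}_q}(\mathrm{Ker}(L))=k$ and $\mathrm{Ker}(L)\cap \mathrm{Im}(L)=\{0\}$. Let $\{\gamma_1,\dots,\gamma_k\}$ be a basis of $\mathrm{Ker}(L)$ over $\mathbf{F}_q$ and let $h_1(x),\dots,h_k(x)\in \mathbf{F}_q[x]$ be permutation polynomials of $\mathbf{F}_q$. Let $f_1,\dots,f_k:\mathbf{F}_{q^m}\to\mathbf{F}_q$ be functions and let $b_{ij}\in\mathbf{F}_q$ ($1\le i,j\le k$) be such that, for all integers $i,j$ with $1\le i,j\le k$, $\gamma_i$ is a $b_{ij}$-linear translator of $f_j$. Then $F(x):=L(x)+\sum_{j=1}^k\gamma_j h_j(f_j(x))$ is a permutation polynomial of $\mathbf{F}_{q^m}$ if and only if $\det(b_{ij})_{1\le i,j\le k}\neq 0$.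
   Context: $\mathbf{F}_{r}$ denotes the finite field with $r$ elements. A polynomial (or the map it induces) is a permutation polynomial of a finite field if it induces a bijection of that field onto itself; maps on finite fields are identified with polynomials. A linearized polynomial over $\mathbf{F}_{q^m}$ is a polynomial $L(x)=\sum_{i=0}^{m-1}a_i x^{q^i}\in\mathbf{F}_{q^m}[x]$; it induces an $\mathbf{F}_q$-linear map on $\mathbf{F}_{q^m}$ with kernel $\mathrm{Ker}(L)$ and image $\mathrm{Im}(L)$. Linear translator: let $f:\mathbf{F}_{q^m}\to\mathbf{F}_q$, $a\in\mathbf{F}_q$ and let $\alpha$ be a nonzero element of $\mathbf{F}_{q^m}$. One says $\alpha$ is an $a$-linear translator of $f$ if $f(x+u\alpha)-f(x)=ua$ for all $x\in\mathbf{F}_{q^m}$ and all $u\in\mathbf{F}_q$. *)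

(* Defs.v *)
From HB Require Import structures.
From mathcomp Require Import all_boot all_order all_fingroup all_algebra all_solvable all_field.

Set Implicit Arguments.
Unset Strict Implicit.
Unset Printing Implicit Defensive.

Import GRing.Theory.
Local Open Scope ring_scope.

Definition permutation_map (T : Type) (g : T -> T) : Prop := bijective g.

Definition permutation_poly (R : nzRingType) (P : {poly R}) : Prop :=
  permutation_map (fun x : R => P.[x]).

(* F plays the role of F_q with q = #|F|, and E that of F_(q^m), where m is the
   dimension of E over F. *)
Definition linearized_poly (F : finFieldType) (E : fieldExtType F) (m : nat)
    (a : 'I_m -> E) : {poly E} :=
  \sum_(i < m) a i *: 'X^(#|F| ^ i).

(* linfun only makes sense on linear functions; linearized_mapE below shows that
   this is indeed the map induced by the polynomial. *)
Definition linearized_map (F : finFieldType) (E : fieldExtType F) (m : nat)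
    (a : 'I_m -> E) : 'End(E) :=
  linfun (fun x : E => (linearized_poly a).[x]).

Lemma linearized_poly_is_linear (F : finFieldType) (E : fieldExtType F)
    (m : nat) (a : 'I_m -> E) :
  linear (fun x : E => (linearized_poly a).[x]).
Proof.
have [p p_pr pF] := finPcharP F.
have pE : p \in [pchar E] by rewrite pchar_lalg.
have pG : p.-nat #|F|.
  by rewrite -cardsT; case/and3P: (fin_ring_pchar_abelem pF).
have expD i (x y : E) :
    (x + y) ^+ (#|F| ^ i) = x ^+ (#|F| ^ i) + y ^+ (#|F| ^ i).
  by rewrite exprDn_pchar // pnatX (eq_pnat _ (pcharf_eq pE)) pG.
have expF i (c : F) : c ^+ (#|F| ^ i) = c.
  by elim: i => [|i IHi]; rewrite ?expr1 // expnSr exprM IHi expf_card.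
move=> c x y; rewrite /linearized_poly !horner_sum scaler_sumr -big_split /=.
apply: eq_bigr => i _.
by rewrite !hornerZ !hornerXn expD exprZn expF mulrDr scalerAr.
Qed.

Lemma linearized_mapE (F : finFieldType) (E : fieldExtType F) (m : nat)
    (a : 'I_m -> E) (x : E) :
  linearized_map a x = (linearized_poly a).[x].
Proof.
pose g (y : E) := (linearized_poly a).[y].
pose gL := GRing.isLinear.Build F E E *:%R g (linearized_poly_is_linear a).
pose gl : {linear E -> E} := HB.pack g gL.
exact: (lfunE gl).
Qed.

Definition linear_translator (F : finFieldType) (E : fieldExtType F)
    (f : E -> F) (a : F) (alpha : E) : Prop :=
  alpha != 0 /\ forall (x : E) (u : F), f (x + u *: alpha) - f x = u * a.

(* Main.v *)
(* Write w(u) for the combination of the gamma_i with coefficient vector u.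
   By the translator property, moving x by w(u) moves the vector
   (f_1 x, .., f_k x) by u b, and it does not change L(x).  Since Ker L and Im L
   meet trivially and the h_j are injective, two points have the same image
   under the map exactly when they differ by some w(u) with u b = 0; so the map
   is injective, hence bijective, exactly when b has trivial row kernel. *)

Require Import Defs.
From mathcomp Require Import all_boot all_order all_algebra all_field.

Import GRing.Theory.
Local Open Scope ring_scope.

(** The translator property holds at every base point, so the terms can be added one at a time, each
    shift starting from [x] plus a partial sum. *)
Lemma linear_translator_sum (F : finFieldType) (E : fieldExtType F) (k : nat)
    (g : E -> F) (c : 'I_k -> F) (gamma : 'I_k -> E)
    (g_translator : forall i, linear_translator g (c i) (gamma i))
    (x : E) (u : 'I_k -> F) :
  g (x + \sum_i u i *: gamma i) = g x + \sum_i u i * c i.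
Proof.
elim/big_rec2: _ => [|i s t _ IH]; first by rewrite !addr0.
have [_ /(_ (x + t) (u i)) /eqP] := g_translator i.
by rewrite subr_eq (addrC (u i *: _)) addrA => /eqP ->; rewrite IH addrCA.
Qed.

(** [finvect_type E] is [E] seen as a finite type, where counting applies. *)
Lemma fieldExt_inj_bij (F : finFieldType) (E : fieldExtType F) (g : E -> E) :
  injective g -> bijective g.
Proof. exact: (@injF_bij (finvect_type E)). Qed.

Theorem theorem2p1 (p n q m k : nat) (p_prime : prime p) (n_ge1 : (1 <= n)%N)
    (q_def : q = (p ^ n)%N) (m_gt1 : (1 < m)%N) (k_gt0 : (0 < k)%N)
    (F : finFieldType) (cardF : #|F| = q)
    (E : fieldExtType F) (dimE : \dim {:E} = m)
    (a : 'I_m -> E)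
    (dim_ker : \dim (lker (linearized_map a)) = k)
    (ker_cap_im :
      (lker (linearized_map a) :&: limg (linearized_map a) = 0)%VS)
    (gamma : k.-tuple E)
    (gamma_basis : basis_of (lker (linearized_map a)) gamma)
    (h : 'I_k -> {poly F}) (h_perm : forall j : 'I_k, permutation_poly (h j))
    (f : 'I_k -> E -> F) (b : 'M[F]_k)
    (f_translator : forall i j : 'I_k,
      linear_translator (f j) (b i j) (tnth gamma i)) :
  permutation_map (fun x : E =>
    (linearized_poly a).[x] + \sum_(j < k) (h j).[f j x] *: tnth gamma j)
  <-> \det b != 0.
Proof.
set L := linearized_map a in dim_ker ker_cap_im gamma_basis *.
have [/eqP span_gamma free_gamma] := andP gamma_basis.
have gamma_nth (j : 'I_k) : tnth gamma j = gamma`_j by rewrite (tnth_nth 0).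
have coef0 (u : 'I_k -> F) :
  \sum_j u j *: tnth gamma j = 0 -> forall j, u j = 0.
  by under eq_bigr do rewrite gamma_nth; move/(freeP free_gamma).
have sum_ker (u : 'I_k -> F) : \sum_j u j *: tnth gamma j \in lker L.
  by apply: memv_suml => j _; rewrite memvZ // -span_gamma memv_span ?mem_tnth.
have f_shift x (u : 'rV_k) j :
  f j (x + \sum_i u 0 i *: tnth gamma i) = f j x + (u *m b) 0 j.
  by rewrite (@linear_translator_sum _ _ _ _ (fun i => b i j)) ?mxE.
split=> [/bij_inj F_inj | det_b].
  apply/negP => /det0P[u u_neq0 ub0]; case/negP: u_neq0; apply/eqP/rowP => i.
  (* The two points compared are [0] and its shift by [u]; the added [0] is the base point needed by
     [f_shift]. *)
  rewrite mxE; apply: (coef0 (u 0)) i; rewrite -[LHS]add0r; apply: F_inj.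
  have /eqP Lw0 : L (\sum_j u 0 j *: tnth gamma j) == 0 by rewrite -memv_ker.
  rewrite /= -!linearized_mapE -/L; congr (_ + _).
    by rewrite add0r Lw0 linear0.
  by apply: eq_bigr => j _; rewrite f_shift ub0 mxE addr0.
apply: fieldExt_inj_bij => x y; rewrite -!linearized_mapE -/L => Fxy.
pose d j := (h j).[f j y] - (h j).[f j x].
have Lxy : L (x - y) = \sum_j d j *: tnth gamma j.
  under eq_bigr do rewrite scalerBl.
  rewrite sumrB linearB /=; apply/eqP.
  by rewrite subr_eq addrAC -subr_eq opprK Fxy addrC.
(* This value is in the image of [L], and also in its kernel as a combination of the [gamma]
   vectors. *)
have Lxy0 : L (x - y) = 0.
  apply/eqP; rewrite -memv0 -ker_cap_im memv_cap memv_img ?memvf // andbT.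
  by rewrite Lxy sum_ker.
(* Freeness of [gamma] makes each [d j] vanish, and [h j] is injective. *)
have fxy j : f j x = f j y.
  apply: (bij_inj (h_perm j)); apply/esym/eqP; rewrite -subr_eq0; apply/eqP.
  by apply: (coef0 d) j; rewrite -Lxy.
have : x - y \in <<gamma>>%VS by rewrite span_gamma memv_ker Lxy0.
move=> /coord_span; set c := fun i => coord gamma i (x - y) => xy.
pose u : 'rV_k := \row_i c i.
have {}xy : x = y + \sum_i u 0 i *: tnth gamma i.
  rewrite -[LHS](subrKC y) [in LHS]xy; congr (_ + _); apply: eq_bigr => i _.
  by rewrite mxE gamma_nth.
(* Passing from [y] to [x] adds the entries of [u *m b] to the values [f j y], which do not
   change. *)
have ub0 : u *m b = 0.
  apply/rowP => j; rewrite [RHS]mxE; apply: (addrI (f j y)).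
  by rewrite -f_shift -xy fxy addr0.
have u0 : u = 0.
  by apply: contraNeq det_b => u_neq0; apply/det0P; exists u.
by rewrite xy u0 big1 ?addr0 // => i _; rewrite mxE scale0r.
Qed.
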